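(* There exists an orientation reversing homeomorphism $h:\mathbb{R}^2\rightarrow\mathbb{R}^2$ with no fixed point such that: (1) the set of all periodic points of $h$ consists of $2$-periodic points and is equal to $\big((-\infty,-1]\cup[1,\infty)\big)\times\{0\}$, i.e. the subset $(-\infty,-1]\cup[1,\infty)$ of the $x$-axis; (2) for each non-periodic point $x\in\mathbb{R}^2$, the orbit $O(x,h)$ of $x$ is bounded, and the limit sets satisfy $\omega(x,h)=\alpha(x,h)=\{(-1,0),(1,0)\}$.
   Context: Let $X$ be a metric space and $f:X\rightarrow X$ a homeomorphism. Here $f^0$ is the identity and $f^n=f\circ f^{n-1}$. The orbit of $x\in X$ is $O(x,f)=\{f^n(x):n\in\mathbb{Z}\}$. A point $x$ is a fixed point if $f(x)=x$. It is a periodic point if $f^n(x)=x$ for some positive integer $n$; the smallest such $n$ is its period, and a periodic point of period $n$ is called an $n$-periodic point. The $\omega$-limit set $\omega(x,f)$ is the set of all $y\in X$ for which there is a sequence of positive integers $n_1<n_2<\cdots$ with $f^{n_i}(x)\rightarrow y$. The $\alpha$-limit set is $\alpha(x,f)=\omega(x,f^{-1})$. *)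

(* Defs.v *)
From HB Require Import structures.
From mathcomp Require Import all_boot all_order all_algebra.
From mathcomp Require Import all_classical all_reals all_analysis.

Set Implicit Arguments.
Unset Strict Implicit.
Unset Printing Implicit Defensive.

Import Order.TTheory GRing.Theory Num.Theory.
Import numFieldNormedType.Exports.

Local Open Scope classical_set_scope.
Local Open Scope ring_scope.

(* [f] is a homeomorphism and [g] is its inverse. *)
Definition homeomorphism_with_inverse (X Y : topologicalType)
    (f : X -> Y) (g : Y -> X) : Prop :=
  [/\ continuous f, continuous g, cancel f g & cancel g f].

Section Dynamics.
Context {X : topologicalType}.
Implicit Types (f g : X -> X) (x y : X).

(* The [z]-th power of the invertible map [f], whose inverse is [g];
   [Negz n] stands for the integer [- n.+1]. *)
Definition iterz f g (z : int) : X -> X :=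
  match z with
  | Posz n => iter n f
  | Negz n => iter n.+1 g
  end.

Definition full_orbit f g x : set X := [set y | exists z : int, y = iterz f g z x].

Definition fixed_point f x : Prop := f x = x.

Definition periodic_point f x : Prop :=
  exists2 n : nat, (0 < n)%N & iter n f x = x.

Definition n_periodic_point (n : nat) f x : Prop :=
  [/\ (0 < n)%N, iter n f x = x &
      forall m : nat, (0 < m)%N -> iter m f x = x -> (n <= m)%N].

Definition omega_limit f x : set X :=
  [set y | exists n : nat -> nat,
     [/\ forall i, (0 < n i)%N,
         forall i, (n i < n i.+1)%N &
         iter (n i) f x @[i --> \oo] --> y]].

(* The alpha-limit set of the homeomorphism whose inverse is [g]. *)
Definition alpha_limit g x : set X := omega_limit g x.

End Dynamics.

Section Orientation.
Context {R : realType}.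
Implicit Types (h : R * R -> R * R) (c : R -> R * R) (p : R * R).

(* [c], restricted to [0, 1], is a closed curve in the plane minus [p]. *)
Definition loop_avoiding p c : Prop :=
  [/\ {within `[0, 1], continuous c}, c 0 = c 1 &
      forall t, t \in `[0, 1] -> c t != p].

(* [rho] and [theta] are polar coordinates of [c] around [p], with a continuous
   choice of the angle; the winding number is the total variation of the angle
   in units of [2 * pi].  Every loop avoiding [p] has exactly one such [k]. *)
Definition has_winding_number p c (k : int) : Prop :=
  exists rho theta : R -> R,
    [/\ {within `[0, 1], continuous theta},
        forall t, t \in `[0, 1] ->
          0 < rho t /\
          c t = (p.1 + rho t * cos (theta t), p.2 + rho t * sin (theta t)) &
        theta 1 - theta 0 = k%:~R * (2 * pi)].

(* A homeomorphism of the plane is orientation reversing when its local degree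
   is -1, i.e. when it acts as -1 on the first homology group of the punctured
   plane, which is detected by winding numbers. *)
Definition orientation_reversing h : Prop :=
  forall p c (k : int), loop_avoiding p c ->
    has_winding_number p c k -> has_winding_number (h p) (h \o c) (- k).

End Orientation.

(* Main.v *)
Require Import Defs.
From HB Require Import structures.
From mathcomp Require Import all_boot all_order all_algebra.
From mathcomp Require Import all_classical all_reals all_analysis.
From mathcomp Require Import ring lra.

Import Order.TTheory GRing.Theory Num.Theory.
Import numFieldNormedType.Exports.

Local Open Scope classical_set_scope.
Local Open Scope ring_scope.

(* The plane minus the two rays of fixed points of h^2, called slits below, is
   parametrized by (w, t) in R^2 through z = tanh((w + i phi) / 2),
   t = tan(phi / 2): the poles -1 and 1 lie at
   w = -oo and w = +oo, and both sides of the slits lie at t = -oo and t = +oo.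
   Take h = (w, t) |-> (c(t) - w, t + 1).  When c vanishes at infinity, h extends
   continuously by (x, y) |-> (-x, y) on the slits.  When moreover
   c(t) = G(t) + G(t + 1), h is conjugate to a glide reflection and
   h^n(w, t) = (G(t + n) + (-1)^n (w - G(t)), t + n), so every orbit alternates
   between the two poles as soon as |G(t + n)| tends to infinity for every t.
   G(t) = |t|^(1/2) cos(pi t) + |t|^(1/4) sin(pi t) has both properties.
   Finally (w, t) |-> (s c(t) - w, t + s), 0 <= s <= 1, is an isotopy from the
   reflection (x, y) |-> (-x, y) to h, and isotopies preserve winding numbers. *)

(** * Bipolar coordinates *)

Section BipolarCoordinates.
Context {R : realType}.
Implicit Types (z : R * R) (a t l s : R).

(* With [z] read as a complex number, [alpha] and [beta] are [|1 + z|^2] and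
   [|1 - z|^2], so [rho] is [|1 - z^2|].  Off the slits, (1 + z) / (1 - z) has
   modulus [ratio z] and an argument whose half has tangent [height z]; [chart]
   is the inverse of these coordinates. *)
Definition alpha z : R := (1 + z.1) ^+ 2 + z.2 ^+ 2.
Definition beta z : R := (1 - z.1) ^+ 2 + z.2 ^+ 2.
Definition power z : R := 1 - z.1 ^+ 2 - z.2 ^+ 2.
Definition rho z : R := Num.sqrt (alpha z * beta z).
Definition slit z : bool := (z.2 == 0) && (1 <= `|z.1|).
Definition ratio z : R := alpha z / rho z.
Definition height z : R := 2 * z.2 / (rho z + power z).
Definition chart a t : R * R :=
  let d := (a - 1) ^+ 2 * (1 + t ^+ 2) + 4 * a in
  ((a ^+ 2 - 1) * (1 + t ^+ 2) / d, 4 * t * a / d).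

Lemma alpha_ge0 z : 0 <= alpha z.
Proof. by rewrite addr_ge0 ?sqr_ge0. Qed.

Lemma beta_ge0 z : 0 <= beta z.
Proof. by rewrite addr_ge0 ?sqr_ge0. Qed.

Lemma rho_ge0 z : 0 <= rho z.
Proof. exact: sqrtr_ge0. Qed.

Lemma rho_sqr z : rho z ^+ 2 = alpha z * beta z.
Proof. by rewrite sqr_sqrtr // mulr_ge0 ?alpha_ge0 ?beta_ge0. Qed.

(** The complex number [power z] + 2i [z.2] is (1 + z)(1 - conj z); its modulus is [rho z] and its
    argument is that of (1 + z) / (1 - z). *)
Lemma rho_sqr_power z : rho z ^+ 2 = power z ^+ 2 + 4 * z.2 ^+ 2.
Proof. by rewrite rho_sqr /alpha /beta /power; ring. Qed.

Lemma rho_unique z r : 0 <= r -> alpha z * beta z = r ^+ 2 -> rho z = r.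
Proof. by move=> r0 e; rewrite /rho e sqrtr_sqr ger0_norm. Qed.

Lemma rho_power_ge0 z : 0 <= rho z + power z.
Proof.
have := rho_sqr_power z; have := rho_ge0 z; have := sqr_ge0 z.2.
by move: (rho z) (power z) (z.2 ^+ 2) => r p y *; nra.
Qed.

(** Modulus plus real part of a complex number is zero exactly when the number is a nonpositive
    real; the number here is [power z] + 2i [z.2]. *)
Lemma slitE z : slit z = (rho z + power z == 0).
Proof.
have := rho_sqr_power z; have := rho_ge0 z.
rewrite /slit => r0 e; apply/andP/eqP => [[/eqP y0 x1]|e0].
  have x2 : 1 <= z.1 ^+ 2 by rewrite -real_normK ?num_real // expr_ge1.
  have p0 : power z <= 0 by rewrite /power y0; nra.
  have : (rho z + power z) * (rho z - power z) = 0.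
    by rewrite mulrC -subr_sqr e y0 expr0n mulr0 addr0 subrr.
  move=> /eqP; rewrite mulf_eq0 => /orP[/eqP ->|/eqP k]; lra.
have y2 : z.2 ^+ 2 = 0 by nra.
have y0 : z.2 = 0 by apply/eqP; rewrite -sqrf_eq0 y2.
split; first exact/eqP.
rewrite -(@ler_pXn2r _ 2) ?nnegrE // expr1n real_normK ?num_real //.
have : power z <= 0 by lra.
by rewrite /power y2; lra.
Qed.

Lemma slitP z : slit z <->
  ((`]-oo, (-1 : R)] `|` `[(1 : R), +oo[) `*` [set (0 : R)]) z.
Proof.
rewrite /slit ler_normr lerNr; split=> [/andP[/eqP y0 x1]|[/= x1 ->]].
  by split=> //=; rewrite !in_itv /= andbT; case/orP: x1; [right|left].
rewrite eqxx /=; apply/orP.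
by move: x1; rewrite !in_itv /= andbT => -[]; [right|left].
Qed.

Lemma rho_power_gt0 z : ~~ slit z -> 0 < rho z + power z.
Proof. by rewrite slitE lt_def rho_power_ge0 andbT. Qed.

Lemma rho_gt0 z : ~~ slit z -> 0 < rho z.
Proof.
move=> /rho_power_gt0 p0; rewrite lt_def rho_ge0 andbT; move: p0.
have := rho_sqr_power z; case: (eqVneq (rho z) 0) => // -> e0 e1.
suff : power z ^+ 2 = 0 by nra.
have := sqr_ge0 z.2; have := sqr_ge0 (power z); lra.
Qed.

Lemma alpha_beta_gt0 z : 0 < rho z -> 0 < alpha z /\ 0 < beta z.
Proof.
rewrite sqrtr_gt0 !lt_def alpha_ge0 beta_ge0 mulf_eq0 negb_or !andbT.
by move=> /andP[/andP[]].
Qed.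

Lemma ratio_gt0 z : ~~ slit z -> 0 < ratio z.
Proof.
move=> /rho_gt0 r0; rewrite divr_gt0 //.
by have [] := alpha_beta_gt0 _ r0.
Qed.

Lemma chart_den_gt0 a t : 0 < a -> 0 < (a - 1) ^+ 2 * (1 + t ^+ 2) + 4 * a.
Proof. by move=> a0; have := sqr_ge0 (a - 1); have := sqr_ge0 t; nra. Qed.

Section ChartInverse.
Context (a t : R) (a0 : 0 < a).
Let d := (a - 1) ^+ 2 * (1 + t ^+ 2) + 4 * a.

Let d0 : d != 0.
Proof. by rewrite gt_eqF // chart_den_gt0. Qed.

Lemma rho_chart : rho (chart a t) = 4 * a * (1 + t ^+ 2) / d.
Proof.
apply: rho_unique.
  apply: divr_ge0; last by rewrite ltW // chart_den_gt0.
  by rewrite !mulr_ge0 ?addr_ge0 ?sqr_ge0 // ltW.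
by rewrite /alpha /beta /chart /= -/d; move: d0; rewrite /d => ?; field.
Qed.

Lemma rho_power_chart : rho (chart a t) + power (chart a t) = 8 * a / d.
Proof.
rewrite rho_chart /power /chart /= -/d.
by move: d0; rewrite /d => ?; field.
Qed.

Lemma chart_nslit : ~~ slit (chart a t).
Proof.
by rewrite slitE rho_power_chart gt_eqF // divr_gt0 ?chart_den_gt0 ?mulr_gt0.
Qed.

Lemma height_chart : height (chart a t) = t.
Proof.
rewrite /height rho_power_chart /chart /= -/d.
have a1 : a != 0 by rewrite gt_eqF.
by move: d0; rewrite /d => d1; field; rewrite d1.
Qed.

Lemma ratio_chart : ratio (chart a t) = a.
Proof.
rewrite /ratio rho_chart /alpha /chart /= -/d.
have a1 : a != 0 by rewrite gt_eqF.
have t1 : 1 + t ^+ 2 != 0 by rewrite gt_eqF //; have := sqr_ge0 t; lra.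
by move: d0; rewrite /d => d1; field; rewrite d1 t1.
Qed.

End ChartInverse.

(** Half-angle formula 1 + tan^2 (phi / 2) = 2 / (1 + cos phi), with cos phi = [power z / rho z]. *)
Lemma height_sqr z : ~~ slit z ->
  1 + height z ^+ 2 = 2 * rho z / (rho z + power z).
Proof.
move=> nz; have p0 := rho_power_gt0 _ nz.
rewrite /height expr_div_n exprMn -(addrK (power z ^+ 2) (2 ^+ 2 * _)).
have -> : 2 ^+ 2 * z.2 ^+ 2 + power z ^+ 2 = rho z ^+ 2.
  by rewrite rho_sqr_power; ring.
by field; rewrite gt_eqF.
Qed.

Lemma alphaBbeta z : alpha z - beta z = 4 * z.1.
Proof. by rewrite /alpha /beta; ring. Qed.

Lemma alphaDbeta z : alpha z + beta z + 2 * power z = 4.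
Proof. by rewrite /alpha /beta /power; ring. Qed.

Lemma chartK z : ~~ slit z -> chart (ratio z) (height z) = z.
Proof.
move=> nz; have p0 := rho_power_gt0 _ nz; have r0 := rho_gt0 _ nz.
have [al0 be0] := alpha_beta_gt0 _ r0.
have r1 : rho z != 0 by rewrite gt_eqF.
have p1 : rho z + power z != 0 by rewrite gt_eqF.
have al1 : alpha z != 0 by rewrite gt_eqF.
have be1 : beta z != 0 by rewrite gt_eqF.
(* As [alpha z + beta z] is 4 - 2 [power z], expanding the square produces a term that cancels 4
   [ratio z]. *)
have dE : (ratio z - 1) ^+ 2 * (1 + height z ^+ 2) + 4 * ratio z
    = 8 * alpha z / (rho z * (rho z + power z)).
  rewrite height_sqr // /ratio.
  have -> : (alpha z / rho z - 1) ^+ 2 =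
      alpha z * (alpha z + beta z - 2 * rho z) / rho z ^+ 2.
    by rewrite mulrBr mulrDr -rho_sqr; field.
  have -> : alpha z + beta z = 4 - 2 * power z by rewrite -(alphaDbeta z); ring.
  by field; rewrite p1.
rewrite /chart /= dE [RHS]surjective_pairing.
 congr (_, _).
  rewrite height_sqr // /ratio expr_div_n rho_sqr.
  have -> : z.1 = (alpha z - beta z) / 4 by rewrite alphaBbeta; field.
  have -> : alpha z ^+ 2 / (alpha z * beta z) - 1 = (alpha z - beta z) / beta z.
    by field; rewrite ?al1 ?be1.
  apply: (@mulIf _ (alpha z * beta z)); first by rewrite mulf_neq0.
  rewrite -[in RHS]rho_sqr; by field; rewrite ?r1 ?p1 ?al1 ?be1.
by rewrite /height /ratio; field; rewrite ?r1 ?p1 ?al1 ?be1.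
Qed.

End BipolarCoordinates.

(** * The twist maps and their formula across the slits *)

Section Twist.
Context {R : realType} (c : R -> R).
Implicit Types (z : R * R) (a t s : R).

(** Here [ratio z] stands for exp w, which avoids logarithms. Negative [s] supply the inverse
    maps. *)
Definition twist s z : R * R :=
  if slit z then (- z.1, z.2)
  else chart (expR (s * c (height z)) / ratio z) (height z + s).

Lemma twist_slit s z : slit z -> twist s z = (- z.1, z.2).
Proof. by rewrite /twist => ->. Qed.

Lemma twist_chart s a t : 0 < a ->
  twist s (chart a t) = chart (expR (s * c t) / a) (t + s).
Proof.
by move=> a0; rewrite /twist (negbTE (chart_nslit a t a0)) height_chart //
  ratio_chart.
Qed.

Lemma slit_reflect z : slit (- z.1, z.2) = slit z.
Proof. by rewrite /slit /= normrN. Qed.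

Lemma chart_inv a t : 0 < a -> chart a^-1 t = (- (chart a t).1, (chart a t).2).
Proof.
move=> a0; have a1 : a != 0 by rewrite gt_eqF.
have := chart_den_gt0 a t a0; move/lt0r_neq0 => d0.
have : (a^-1 - 1) ^+ 2 * (1 + t ^+ 2) + 4 * a^-1 != 0.
  by rewrite gt_eqF // chart_den_gt0 // invr_gt0.
have -> : (a^-1 - 1) ^+ 2 * (1 + t ^+ 2) + 4 * a^-1
  = ((a - 1) ^+ 2 * (1 + t ^+ 2) + 4 * a) / a ^+ 2 by field.
rewrite /chart /= => d1.
have -> : (a^-1 - 1) ^+ 2 * (1 + t ^+ 2) + 4 * a^-1
  = ((a - 1) ^+ 2 * (1 + t ^+ 2) + 4 * a) / a ^+ 2 by field.
by congr (_, _); field; rewrite d0.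
Qed.

Lemma twist0 z : twist 0 z = (- z.1, z.2).
Proof.
rewrite /twist; case: ifPn => // nz.
by rewrite mul0r expR0 addr0 div1r chart_inv ?ratio_gt0 // chartK.
Qed.

(* Multiplying (1 + z) / (1 - z) through by the denominators gives a formula
   for [twist] that remains valid, hence continuous, across the slits:
   [(num1 s z, num2 s z)] is [rho z] times the unit vector with half-angle
   tangent [height z + s]. *)
Definition slit_cst z : R := if slit z then 0 else c (height z).
Definition delta s z : R := 2 * rho z + 4 * s * z.2 + s ^+ 2 * (rho z + power z).
Definition num1 s z : R := rho z * (2 * (rho z + power z) - delta s z) / delta s z.
Definition num2 s z : R := 2 * rho z * (2 * z.2 + s * (rho z + power z)) / delta s z.
Definition lam s z : R := expR (s * slit_cst z).
Definition den s z : R :=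
  lam s z ^+ 2 * beta z + alpha z + 2 * lam s z * num1 s z.

(** This explains [delta]: clearing the denominator of 1 + ([height z] + s)^2 leaves an expression
    without division, which on the slits equals 2 [rho z]. *)
Lemma delta_nslit s z : ~~ slit z ->
  1 + (height z + s) ^+ 2 = delta s z / (rho z + power z).
Proof.
move=> nz; have p0 := rho_power_gt0 _ nz.
transitivity (1 + height z ^+ 2 + 2 * s * height z + s ^+ 2); first by ring.
by rewrite height_sqr // /delta /height; field; rewrite gt_eqF.
Qed.

Lemma delta_gt0 s z : 0 < rho z -> 0 < delta s z.
Proof.
move=> r0; case: (boolP (slit z)) => [zs|nz].
  have /andP[/eqP y0 _] := zs.
  by move: zs; rewrite slitE /delta => /eqP ->; rewrite y0; lra.
have p0 := rho_power_gt0 _ nz.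
have -> : delta s z = (1 + (height z + s) ^+ 2) * (rho z + power z).
  by rewrite delta_nslit // divfK // gt_eqF.
by rewrite mulr_gt0 // ltr_pwDl // sqr_ge0.
Qed.

(** Off the poles this is cos^2 + sin^2 = 1 scaled by [rho z ^+ 2]; at the poles the factor [rho z]
    kills both terms. The bound forces [num1] and [num2] to tend to 0 at the poles, where [delta]
    vanishes as well. *)
Lemma num_sqr s z : num1 s z ^+ 2 + num2 s z ^+ 2 <= rho z ^+ 2.
Proof.
have [r0|r0] := eqVneq (rho z) 0.
  by rewrite /num1 /num2 r0 !(mulr0, mul0r) !expr0n addr0.
have d0 : delta s z != 0.
  by rewrite gt_eqF // delta_gt0 // lt_def r0 rho_ge0.
suff -> : num1 s z ^+ 2 + num2 s z ^+ 2 = rho z ^+ 2 by [].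
have -> : num1 s z ^+ 2 + num2 s z ^+ 2 =
   rho z ^+ 2 * ((2 * (rho z + power z) - delta s z) ^+ 2 +
     4 * (2 * z.2 + s * (rho z + power z)) ^+ 2) / delta s z ^+ 2.
  by rewrite /num1 /num2; field.
have -> : (2 * (rho z + power z) - delta s z) ^+ 2 +
     4 * (2 * z.2 + s * (rho z + power z)) ^+ 2 = delta s z ^+ 2 +
     4 * (4 * z.2 ^+ 2 + power z ^+ 2 - rho z ^+ 2).
  by rewrite /delta; ring.
rewrite rho_sqr_power; field; exact: d0.
Qed.

Lemma num1_le s z : `|num1 s z| <= rho z.
Proof.
rewrite -(@ler_pXn2r _ 2) ?nnegrE ?rho_ge0 // real_normK ?num_real //.
by have := num_sqr s z; have := sqr_ge0 (num2 s z); lra.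
Qed.

Lemma num2_le s z : `|num2 s z| <= rho z.
Proof.
rewrite -(@ler_pXn2r _ 2) ?nnegrE ?rho_ge0 // real_normK ?num_real //.
by have := num_sqr s z; have := sqr_ge0 (num1 s z); lra.
Qed.

(** Relates [den] to the denominator of [chart] by a positive factor, so that [den] inherits
    positivity from [chart_den_gt0]. *)
Lemma twist_nslit_den s z : ~~ slit z ->
  let l := lam s z / ratio z in
  (l - 1) ^+ 2 * (1 + (height z + s) ^+ 2) + 4 * l
    = delta s z * den s z / (alpha z * (rho z + power z)).
Proof.
move=> nz l; have p0 := rho_power_gt0 _ nz; have r0 := rho_gt0 _ nz.
have [al0 be0] := alpha_beta_gt0 _ r0.
have d0 := delta_gt0 s z r0.
have r1 : rho z != 0 by rewrite gt_eqF.
have p1 : rho z + power z != 0 by rewrite gt_eqF.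
have al1 : alpha z != 0 by rewrite gt_eqF.
have d1 : delta s z != 0 by rewrite gt_eqF.
rewrite delta_nslit // /l /ratio.
have -> : (lam s z / (alpha z / rho z) - 1) ^+ 2 =
    (lam s z ^+ 2 * beta z - 2 * lam s z * rho z + alpha z) / alpha z.
  transitivity ((lam s z ^+ 2 * (rho z) ^+ 2
     - 2 * lam s z * rho z * alpha z + alpha z ^+ 2) / alpha z ^+ 2).
    by field; rewrite al1.
  by rewrite rho_sqr; field.
rewrite /den /num1; field; by rewrite ?r1 ?al1 ?d1 ?p1.
Qed.

Lemma den_slit s z : slit z -> den s z = 4.
Proof.
move=> zs; have := zs; rewrite slitE => /eqP p0.
rewrite /den /lam /slit_cst zs mulr0 expR0 /num1.
(* On the slits the angle is pi, of cosine -1. At a pole [delta] is 0 too, but the factor [rho z]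
   makes the quotient 0. *)
have -> : rho z * (2 * (rho z + power z) - delta s z) / delta s z = - rho z.
  have [->|r1] := eqVneq (rho z) 0; first by rewrite !mul0r oppr0.
  rewrite p0 mulr0 sub0r mulrN mulNr mulfK // gt_eqF // delta_gt0 //.
  by rewrite lt_def r1 rho_ge0.
have -> : - rho z = power z by lra.
by have := alphaDbeta z; lra.
Qed.

Lemma den_gt0 s z : 0 < den s z.
Proof.
case: (boolP (slit z)) => [zs|nz]; first by rewrite den_slit.
have p0 := rho_power_gt0 _ nz; have r0 := rho_gt0 _ nz.
have [al0 be0] := alpha_beta_gt0 _ r0.
have l0 : 0 < lam s z / ratio z by rewrite divr_gt0 ?expR_gt0 ?ratio_gt0.
have := chart_den_gt0 _ (height z + s) l0.
rewrite twist_nslit_den //.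
have -> : delta s z * den s z / (alpha z * (rho z + power z))
    = delta s z / (alpha z * (rho z + power z)) * den s z by ring.
by rewrite pmulr_rgt0 // divr_gt0 ?delta_gt0 ?mulr_gt0.
Qed.

(** If (1 + z') / (1 - z') = a exp(i phi), then z' = (a^2 - 1 + 2 i a sin phi) / (a^2 + 1 + 2 a cos
    phi). For the image z' off the slits, a^2 is [lam s z ^+ 2 * beta z / alpha z], and both sides
    of the fraction are multiplied by [alpha z]. *)
Lemma twistE s z : twist s z =
  ((lam s z ^+ 2 * beta z - alpha z) / den s z,
   2 * (lam s z * num2 s z) / den s z).
Proof.
have := den_gt0 s z; case: (boolP (slit z)) => [zs|nz] D0.
  have /andP[/eqP y0 x1] := zs; have p0 := zs; rewrite slitE in p0.
  rewrite twist_slit // /lam /slit_cst zs mulr0 expR0 expr1n mul1r.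
  rewrite den_slit // /num2 (eqP p0) y0 !(mulr0, addr0, mul0r); congr (_, _).
  by rewrite -opprB alphaBbeta; field.
have p0 := rho_power_gt0 _ nz; have r0 := rho_gt0 _ nz.
have [al0 be0] := alpha_beta_gt0 _ r0.
have d0 := delta_gt0 s z r0.
have r1 : rho z != 0 by rewrite gt_eqF.
have p1 : rho z + power z != 0 by rewrite gt_eqF.
have al1 : alpha z != 0 by rewrite gt_eqF.
have be1 : beta z != 0 by rewrite gt_eqF.
have d1 : delta s z != 0 by rewrite gt_eqF.
have D1 : den s z != 0 by rewrite gt_eqF.
rewrite /twist (negbTE nz).
have -> : expR (s * c (height z)) = lam s z by rewrite /lam /slit_cst (negbTE nz).
rewrite /chart /= twist_nslit_den // delta_nslit //; congr (_, _).
  have -> : (lam s z / ratio z) ^+ 2 - 1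
    = (lam s z ^+ 2 * beta z - alpha z) / alpha z.
    transitivity ((lam s z ^+ 2 * (rho z) ^+ 2 - alpha z ^+ 2) / alpha z ^+ 2).
      by rewrite /ratio; field; rewrite al1.
    by rewrite rho_sqr; field.
  by field; rewrite ?d1 ?D1 ?al1 ?p1.
by rewrite /num2 /height /ratio; field; rewrite ?r1 ?p1 ?al1 ?d1 ?D1.
Qed.

End Twist.

(** Solving (w', t') = (s c(t) - w, t + s) gives w = s c(t' - s) - w' and t = t' - s, again a twist;
    the signs of -s and -c cancel. *)
Lemma twistK {R : realType} (c : R -> R) s z :
  twist (fun t => - c (t - s)) (- s) (twist c s z) = z.
Proof.
case: (boolP (slit z)) => zs.
  by rewrite !twist_slit ?slit_reflect //= opprK -surjective_pairing.
have a0 := ratio_gt0 _ zs.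
rewrite -{1}(chartK z zs) twist_chart // twist_chart; last first.
  by rewrite divr_gt0 // expR_gt0.
rewrite !addrK mulrNN invf_div mulrC divfK ?gt_eqF ?expR_gt0 //.
exact: chartK.
Qed.

Lemma twistVK {R : realType} (c : R -> R) s z :
  twist c s (twist (fun t => - c (t - s)) (- s) z) = z.
Proof.
(* Passing from (c, s) to the data of the inverse is an involution, so the other cancellation
   follows from [twistK]. *)
have cE : (fun t => - (fun t => - c (t - s)) (t - - s)) = c.
  by apply/funext => t /=; rewrite !opprK addrK.
have := twistK (fun t => - c (t - s)) (- s) z.
by rewrite cE opprK.
Qed.

(** * Continuity *)

Section CoordinateContinuity.
Context {R : realType} {T : Type} {F : set_system T} {FF : Filter F}.
Implicit Types (z : R * R) (f : T -> R).

Lemma cvg_sqr f (a : R) : f @ F --> a -> f x ^+ 2 @[x --> F] --> a ^+ 2.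
Proof. by move=> fa; rewrite expr2; under eq_fun do rewrite expr2; exact: cvgM. Qed.

Lemma cvg_to_pair f (g : T -> R) (a b : R) :
  f @ F --> a -> g @ F --> b -> (f x, g x) @[x --> F] --> (a, b).
Proof. by move=> fa gb; exact: (cvg_pair fa gb). Qed.

Lemma cvg_bounded_mul0 f (g : T -> R) (B : R) :
  (\near F, `|f F| <= B) -> g @ F --> 0 -> f x * g x @[x --> F] --> 0.
Proof.
move=> fB g0; apply: norm_cvg0.
have {}g0 : `|g x| @[x --> F] --> 0 by rewrite -(@normr0 _ R); exact: cvg_norm.
apply: (@squeeze_cvgr _ _ _ _ (cst 0) (fun x => B * `|g x|)).
- by apply: filterS fB => x fx /=; rewrite normr_ge0 normrM ler_wpM2r.
- exact: cvg_cst.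
- by rewrite -(mulr0 B); apply: cvgM => //; exact: cvg_cst.
Qed.

(* The behaviour of [twist] at [(1, 0)] and [(-1, 0)], where [lam] is bounded
   but has no limit. *)
Lemma pole_cvg (l a b n1 n2 : T -> R) (K : R) :
  (\near F, `|l F| <= K) -> a @ F --> 0 -> b @ F --> (4 : R) ->
  n1 @ F --> 0 -> n2 @ F --> 0 ->
  let d x := b x + l x ^+ 2 * a x + 2 * (l x * n1 x) in
  (b x - l x ^+ 2 * a x) / d x @[x --> F] --> (1 : R) /\
  2 * (l x * n2 x) / d x @[x --> F] --> 0.
Proof.
move=> lK a0 b4 n10 n20 d.
have la : l x ^+ 2 * a x @[x --> F] --> 0.
  apply: (cvg_bounded_mul0 _ _ (K ^+ 2)) => //; apply: filterS lK => x lK.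
  by rewrite normrX lerXn2r // nnegrE (le_trans _ lK).
have ln1 := cvg_bounded_mul0 _ _ _ lK n10.
have ln2 := cvg_bounded_mul0 _ _ _ lK n20.
have dV : (d x)^-1 @[x --> F] --> (4 : R)^-1.
  apply: cvgV => //; have -> : (4 : R) = 4 + 0 + 2 * 0 by rewrite mulr0 !addr0.
  apply: cvgD; first exact: cvgD.
  by apply: cvgM => //; exact: cvg_cst.
split.
  have -> : (1 : R) = (4 - 0) / 4 by rewrite subr0 divff.
  by apply: cvgM => //; exact: cvgB.
rewrite -(mul0r 4^-1); apply: cvgM => //.
by rewrite -(mulr0 2); apply: cvgM => //; exact: cvg_cst.
Qed.

Context (h : T -> R * R) (z : R * R) (hz : h @ F --> z).

Let h1 : (h x).1 @[x --> F] --> z.1.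
Proof. exact: (cvg_comp _ _ hz cvg_fst). Qed.

Let h2 : (h x).2 @[x --> F] --> z.2.
Proof. exact: (cvg_comp _ _ hz cvg_snd). Qed.

Lemma alpha_cvg : alpha (h x) @[x --> F] --> alpha z.
Proof.
by apply: cvgD; apply: cvg_sqr => //; apply: cvgD => //; exact: cvg_cst.
Qed.

Lemma beta_cvg : beta (h x) @[x --> F] --> beta z.
Proof.
by apply: cvgD; apply: cvg_sqr => //; apply: cvgB => //; exact: cvg_cst.
Qed.

Lemma power_cvg : power (h x) @[x --> F] --> power z.
Proof.
apply: cvgB; last exact: cvg_sqr.
by apply: cvgB; [exact: cvg_cst|exact: cvg_sqr].
Qed.

Lemma rho_cvg : rho (h x) @[x --> F] --> rho z.
Proof.
exact: (cvg_comp _ _ (cvgM alpha_cvg beta_cvg) (@sqrt_continuous R _)).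
Qed.

Lemma height_cvg : ~~ slit z -> height (h x) @[x --> F] --> height z.
Proof.
move=> nz; apply: cvgM; first by apply: cvgM => //; exact: cvg_cst.
apply: cvgV; first by rewrite gt_eqF // rho_power_gt0.
by apply: cvgD; [exact: rho_cvg|exact: power_cvg].
Qed.

Context (s : T -> R) (s0 : R) (hs : s @ F --> s0).

Lemma delta_cvg : delta (s x) (h x) @[x --> F] --> delta s0 z.
Proof.
have cr := rho_cvg; have cp := power_cvg.
apply: cvgD; last by apply: cvgM; [exact: cvg_sqr|exact: cvgD].
apply: cvgD; first by apply: cvgM => //; exact: cvg_cst.
by apply: cvgM => //; apply: cvgM => //; exact: cvg_cst.
Qed.

Lemma num1_cvg : 0 < rho z -> num1 (s x) (h x) @[x --> F] --> num1 s0 z.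
Proof.
move=> r0; have cr := rho_cvg; have cp := power_cvg; have cd := delta_cvg.
apply: cvgM; last by apply: cvgV => //; rewrite gt_eqF // delta_gt0.
apply: cvgM => //; apply: cvgB => //.
by apply: cvgM; [exact: cvg_cst|exact: cvgD].
Qed.

Lemma num2_cvg : 0 < rho z -> num2 (s x) (h x) @[x --> F] --> num2 s0 z.
Proof.
move=> r0; have cr := rho_cvg; have cp := power_cvg; have cd := delta_cvg.
apply: cvgM; last by apply: cvgV => //; rewrite gt_eqF // delta_gt0.
apply: cvgM; first by apply: cvgM => //; exact: cvg_cst.
apply: cvgD; first by apply: cvgM => //; exact: cvg_cst.
by apply: cvgM => //; exact: cvgD.
Qed.

Lemma num_cvg0 : rho z = 0 ->
  num1 (s x) (h x) @[x --> F] --> 0 /\ num2 (s x) (h x) @[x --> F] --> 0.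
Proof.
move=> r0; have cr : rho (h x) @[x --> F] --> 0 by rewrite -r0; exact: rho_cvg.
split; apply: norm_cvg0; apply: (@squeeze_cvgr _ _ _ _ (cst 0) _ _ _ 0 _ cr);
  try exact: cvg_cst; apply: nearW => x /=; rewrite normr_ge0.
  exact: num1_le.
exact: num2_le.
Qed.

End CoordinateContinuity.

Section TwistContinuity.
Context {R : realType} (c : R -> R).
Implicit Types (s : R) (z : R * R).

Definition vanishes_at_infinity : Prop :=
  forall e, 0 < e -> exists M : R, forall t, M < `|t| -> `|c t| < e.

Hypothesis cc : continuous c.
Hypothesis c0 : vanishes_at_infinity.

Lemma vanishing_bounded : exists2 B, 0 < B & forall t, `|c t| <= B.
Proof.
have [M hM] := c0 1 ltr01.
(* [M] may be negative, hence the interval with endpoints given by [|M|]. *)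
have ab : - `|M| <= `|M| by rewrite (@le_trans _ _ 0) // oppr_le0.
have cn : {within `[- `|M|, `|M|], continuous (fun t => `|c t|)}.
  by apply: continuous_subspaceT => t; apply: cvg_norm; exact: cc.
have [t0 _ ht] := EVT_max ab cn.
exists (1 + `|c t0|); first by rewrite ltr_pwDl.
move=> t; have [tM|Mt] := leP `|t| `|M|.
  by rewrite (le_trans (ht t _)) ?in_itv /= -?ler_norml // lerDr.
by rewrite ltW // (lt_le_trans (hM t _)) ?lerDl // (le_lt_trans _ Mt) ?ler_norm.
Qed.

(** Near a slit point other than a pole, [rho] stays positive while [rho + power] tends to 0, so
    [height] is unbounded and [c] becomes small. Poles are excluded because [height] takes arbitrary
    values near them. *)
Lemma slit_cst_continuous z : 0 < rho z -> slit_cst c z' @[z' --> z] --> slit_cst c z.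
Proof.
move=> r0; have zz : z' @[z' --> z] --> z by exact: cvg_id.
have rp : rho z' + power z' @[z' --> z] --> rho z + power z.
  by apply: cvgD; [exact: rho_cvg|exact: power_cvg].
have [zs|nz] := boolP (slit z).
  have p0 : rho z + power z = 0 by apply/eqP; rewrite -slitE.
  have s0 : slit_cst c z = 0 by rewrite /slit_cst zs.
  rewrite s0.
  apply/cvgr0Pnorm_lt => e e0; have [M hM] := c0 e e0.
  (* Off the slits, positivity of this quantity says 1 + [height z' ^+ 2] > 1 + M^2, in a form that
     is continuous across the slits. *)
  have lim : 2 * rho z' - (M ^+ 2 + 1) * (rho z' + power z') @[z' --> z]
      --> 2 * rho z - (M ^+ 2 + 1) * (rho z + power z).
    apply: cvgB; last by apply: cvgM => //; exact: cvg_cst.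
    by apply: cvgM; [exact: cvg_cst|exact: rho_cvg].
  have lim0 : 0 < 2 * rho z - (M ^+ 2 + 1) * (rho z + power z).
    by rewrite p0 mulr0 subr0 mulr_gt0.
  apply: filterS (cvgr_gt _ lim _ lim0) => z' hz'.
  rewrite /slit_cst; case: ifPn => [|nz'].
    by rewrite normr0.
  apply: hM; have q0 := rho_power_gt0 _ nz'.
  rewrite (le_lt_trans (ler_norm _)) // -(@ltr_pXn2r _ 2) ?nnegrE //.
  rewrite !real_normK ?num_real // -(ltrD2l 1) height_sqr // addrC.
  by rewrite ltr_pdivlMr // -subr_gt0.
have cz : c (height z') @[z' --> z] --> c (height z).
  by apply: continuous_cvg; [exact: cc|exact: height_cvg].
have sz : slit_cst c z = c (height z) by rewrite /slit_cst (negbTE nz).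
rewrite sz.
apply: cvg_trans cz; apply: near_eq_cvg.
apply: filterS (cvgr_gt _ rp 0 (rho_power_gt0 _ nz)) => z' q0.
by rewrite /slit_cst slitE gt_eqF.
Qed.

Lemma slit_cst_bounded : exists2 B, 0 < B & forall z, `|slit_cst c z| <= B.
Proof.
have [B B0 hB] := vanishing_bounded; exists B => // z.
by rewrite /slit_cst; case: ifP => // _; rewrite normr0 ltW.
Qed.

Context {T : Type} {F : set_system T} {FF : Filter F}.
Context (h : T -> R * R) (s : T -> R) (z0 : R * R) (s0 : R).
Hypotheses (hz : h @ F --> z0) (hs : s @ F --> s0).

Lemma lam_cvg : 0 < rho z0 -> lam c (s x) (h x) @[x --> F] --> lam c s0 z0.
Proof.
move=> r0.
have e : s x * slit_cst c (h x) @[x --> F] --> s0 * slit_cst c z0.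
  apply: cvgM => //.
  exact: (cvg_comp _ _ hz (slit_cst_continuous z0 r0)).
exact: (cvg_comp _ _ e (@continuous_expR R _)).
Qed.

(** The bound on [lam] serves at (1, 0) and the bound on its inverse at (-1, 0). *)
Lemma lam_bounded : exists K,
  (\forall x \near F, `|lam c (s x) (h x)| <= K) /\
  (\forall x \near F, `|(lam c (s x) (h x))^-1| <= K).
Proof.
have [B B0 hB] := slit_cst_bounded.
exists (expR ((`|s0| + 1) * B)).
have near_s : \forall x \near F, `|s x| <= `|s0| + 1.
  have sn : `|s x| @[x --> F] --> `|s0| by exact: cvg_norm.
  by apply: filterS (cvgr_lt _ sn (`|s0| + 1) _) => [q /ltW//|]; rewrite ltrDl.
split; apply: filterS near_s => q hq; rewrite /lam -?expRN ger0_norm ?expR_ge0 //;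
  by rewrite ler_expR (le_trans (ler_norm _)) // ?normrN normrM ler_pM.
Qed.

Lemma twist_cvg : twist c (s x) (h x) @[x --> F] --> twist c s0 z0.
Proof.
have ca : alpha (h x) @[x --> F] --> alpha z0 by exact: alpha_cvg.
have cb : beta (h x) @[x --> F] --> beta z0 by exact: beta_cvg.
under eq_fun do rewrite twistE.
have [r0|] := ltP 0 (rho z0).
  have cl := lam_cvg r0.
  have cn1 : num1 (s x) (h x) @[x --> F] --> num1 s0 z0 by exact: num1_cvg.
  have cn2 : num2 (s x) (h x) @[x --> F] --> num2 s0 z0 by exact: num2_cvg.
  have cd : (den c (s x) (h x))^-1 @[x --> F] --> (den c s0 z0)^-1.
    apply: cvgV; first by rewrite gt_eqF // den_gt0.
    apply: cvgD; last by apply: cvgM => //; apply: cvgM => //; exact: cvg_cst.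
    by apply: cvgD => //; apply: cvgM => //; exact: cvg_sqr.
  rewrite twistE; apply: cvg_to_pair.
    by apply: cvgM => //; apply: cvgB => //; apply: cvgM => //; exact: cvg_sqr.
  apply: cvgM => //; apply: cvgM; first exact: cvg_cst.
  exact: cvgM.
rewrite le_eqVlt ltNge rho_ge0 orbF => /eqP r0.
have [cn1 cn2] := num_cvg0 _ _ hz s r0.
have [K [lK lVK]] := lam_bounded.
have sl x : x ^+ 2 = 1 -> twist c s0 (x, 0) = (- x, 0).
  move=> x1; rewrite twist_slit // /slit eqxx /=.
  by rewrite -(@ler_pXn2r _ 2) ?nnegrE // expr1n real_normK ?num_real // x1.
have lam0 x : lam c (s x) (h x) != 0 by rewrite gt_eqF // expR_gt0.
have den0 x : den c (s x) (h x) != 0 by rewrite gt_eqF // den_gt0.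
have /andP[x1 /eqP y0] : ((1 + z0.1 == 0) || (1 - z0.1 == 0)) && (z0.2 == 0).
  have sq (u v : R) : (u ^+ 2 + v ^+ 2 == 0) = (u == 0) && (v == 0).
    by rewrite paddr_eq0 ?sqr_ge0 // !sqrf_eq0.
  have : alpha z0 * beta z0 == 0 by rewrite -rho_sqr r0 expr0n.
  by rewrite mulf_eq0 /alpha /beta !sq -andb_orl.
have -> : twist c s0 z0 = (- z0.1, 0).
  rewrite (surjective_pairing z0) y0 sl //=.
  by case/orP: x1 => /eqP; nra.
(* At (-1, 0) [alpha] tends to 0 and [beta] to 4; dividing numerator and denominator by [lam ^+ 2]
   gives the form of [pole_cvg] with the inverse of [lam]. *)
case/orP: x1 => /eqP x1.
  have a0 : alpha z0 = 0 by rewrite /alpha x1 y0 expr0n addr0.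
  have b4 : beta z0 = 4 by rewrite /beta y0; nra.
  rewrite a0 in ca; rewrite b4 in cb.
  have [X Y] := pole_cvg _ _ _ _ _ _ lVK ca cb cn1 cn2.
  have -> : - z0.1 = 1 by lra.
  apply: cvg_to_pair; [apply: cvg_trans X|apply: cvg_trans Y];
    apply: near_eq_cvg; apply: nearW => x; have := lam0 x; have := den0 x;
    rewrite /den => d1 l1; field.
    by rewrite l1 d1.
  by rewrite l1 d1.
(* At (1, 0) [alpha] and [beta] exchange roles; [pole_cvg] applies to [lam] itself, up to the sign
   of the first coordinate. *)
have b0 : beta z0 = 0 by rewrite /beta x1 y0 expr0n addr0.
have a4 : alpha z0 = 4 by rewrite /alpha y0; nra.
rewrite b0 in cb; rewrite a4 in ca.
have [X Y] := pole_cvg _ _ _ _ _ _ lK cb ca cn1 cn2.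
have -> : z0.1 = 1 by lra.
have E x : den c (s x) (h x) = alpha (h x) + lam c (s x) (h x) ^+ 2 * beta (h x)
    + 2 * (lam c (s x) (h x) * num1 (s x) (h x)).
  by rewrite /den; ring.
apply: cvg_to_pair; last first.
  by under eq_fun do rewrite E; exact: Y.
by under eq_fun do rewrite E -[_ - alpha _]opprB mulNr; exact: cvgN.
Qed.

End TwistContinuity.

(** * Winding numbers along an isotopy *)

Section WindingNumber.
Context {R : realType}.
Implicit Types (a b p q : R * R) (c d : R -> R * R) (k : int).

Definition dot a b : R := a.1 * b.1 + a.2 * b.2.
Definition cross a b : R := a.1 * b.2 - a.2 * b.1.

(* As [0 < dot a b], the angle from [a] to [b] lies in the range of [atan]. *)
Lemma polar_turn a b (r th : R) : 0 < r -> a = (r * cos th, r * sin th) ->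
  0 < dot a b ->
  let r' := Num.sqrt (b.1 ^+ 2 + b.2 ^+ 2) in
  let th' := th + atan (cross a b / dot a b) in
  0 < r' /\ b = (r' * cos th', r' * sin th').
Proof.
move=> r0 aE D0 r' th'.
have id : cross a b ^+ 2 + dot a b ^+ 2 = r ^+ 2 * r' ^+ 2.
  rewrite sqr_sqrtr ?addr_ge0 ?sqr_ge0 // -[r ^+ 2]mulr1 -(cos2Dsin2 th).
  by rewrite /cross /dot aE /=; ring.
have r'0 : 0 < r'.
  rewrite lt_def sqrtr_ge0 andbT; apply/eqP => e0; move: id.
  by rewrite e0 expr0n mulr0; have := sqr_ge0 (cross a b); nra.
split=> //.
have D1 : dot a b != 0 by rewrite gt_eqF.
have r1 : r != 0 by rewrite gt_eqF.
have r'1 : r' != 0 by rewrite gt_eqF.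
set f := atan _ in th' *.
have cf : cos f = dot a b / (r * r').
  rewrite /f cos_atan.
  have -> : 1 + (cross a b / dot a b) ^+ 2 = (r * r' / dot a b) ^+ 2.
    rewrite !expr_div_n exprMn -id; field; exact: D1.
  by rewrite sqrtr_sqr gtr0_norm ?invf_div // divr_gt0 ?mulr_gt0.
have sf : sin f = cross a b / (r * r').
  have cf0 : cos f != 0 by rewrite cf mulf_neq0 // invr_eq0 mulf_neq0.
  have -> : sin f = tan f * cos f by rewrite /tan divfK.
  by rewrite /f atanK -/f cf; field; rewrite r1 r'1.
have ab : r ^+ 2 = a.1 ^+ 2 + a.2 ^+ 2.
  by rewrite -[LHS]mulr1 -(cos2Dsin2 th) aE /=; ring.
have c1 : cos th = a.1 / r by rewrite aE /=; field.
have s1 : sin th = a.2 / r by rewrite aE /=; field.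
rewrite /th' cosD sinD cf sf c1 s1 (surjective_pairing b) /=.
have n0 : a.1 ^+ 2 + a.2 ^+ 2 != 0 by rewrite -ab expf_neq0.
congr (_, _).
  transitivity ((a.1 ^+ 2 + a.2 ^+ 2) * b.1 / r ^+ 2); first by rewrite -ab; field.
  by rewrite /cross /dot; field; rewrite ?r1 ?r'1.
transitivity ((a.1 ^+ 2 + a.2 ^+ 2) * b.2 / r ^+ 2); first by rewrite -ab; field.
by rewrite /cross /dot; field; rewrite ?r1 ?r'1.
Qed.

End WindingNumber.

Section Homotopy.
Context {R : realType}.
Implicit Types (p q : R * R) (c d : R -> R * R) (k : int).

Lemma dotC p q : dot p q = dot q p.
Proof. by rewrite /dot ![p.1 * _]mulrC ![p.2 * _]mulrC. Qed.

(** The angle from c - p to d - q stays within a right angle, so it is a continuous arctangent.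
    Adding it to an angle of c - p gives an angle of d - q, and it takes equal values at 0 and 1
    because both curves are closed. *)
Lemma has_winding_number_close p q c d k :
  {within `[0, 1], continuous c} -> {within `[0, 1], continuous d} ->
  c 0 = c 1 -> d 0 = d 1 ->
  (forall t, t \in `[0, 1] -> 0 < dot (c t - p) (d t - q)) ->
  has_winding_number p c k -> has_winding_number q d k.
Proof.
move=> cc cd c01 d01 cd0 [rh [th [cth hth th01]]].
pose phi t := atan (cross (c t - p) (d t - q) / dot (c t - p) (d t - q)).
exists (fun t => Num.sqrt ((d t - q).1 ^+ 2 + (d t - q).2 ^+ 2)).
exists (fun t => th t + phi t); split.
- apply/subspace_continuousP => t t01.
  have {}cc := (subspace_continuousP _ c).1 cc t t01.
  have {}cd := (subspace_continuousP _ d).1 cd t t01.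
  have {}cth := (subspace_continuousP _ th).1 cth t t01.
  set F := within _ _ in cc cd cth *.
  have c1 : (c t - p).1 @[t --> F] --> (c t - p).1.
    by apply: cvgB; [exact: (cvg_comp _ _ cc cvg_fst)|exact: cvg_cst].
  have c2 : (c t - p).2 @[t --> F] --> (c t - p).2.
    by apply: cvgB; [exact: (cvg_comp _ _ cc cvg_snd)|exact: cvg_cst].
  have d1 : (d t - q).1 @[t --> F] --> (d t - q).1.
    by apply: cvgB; [exact: (cvg_comp _ _ cd cvg_fst)|exact: cvg_cst].
  have d2 : (d t - q).2 @[t --> F] --> (d t - q).2.
    by apply: cvgB; [exact: (cvg_comp _ _ cd cvg_snd)|exact: cvg_cst].
  apply: cvgD => //.
  have e : cross (c t - p) (d t - q) / dot (c t - p) (d t - q) @[t --> F]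
      --> cross (c t - p) (d t - q) / dot (c t - p) (d t - q).
    apply: cvgM; first by apply: cvgB; apply: cvgM.
    by apply: cvgV; [rewrite gt_eqF // cd0|apply: cvgD; apply: cvgM].
  exact: (cvg_comp _ _ e (@continuous_atan R _)).
- move=> t t01; have [r0 ctE] := hth t t01.
  have [|r'0 dE] := polar_turn (c t - p) (d t - q) (rh t) (th t) r0 _ (cd0 t t01).
    by rewrite ctE; congr (_, _) => /=; rewrite addrAC subrr add0r.
  split=> //; have := congr1 (fun v => q + v) dE.
  by rewrite [LHS]addrCA subrr addr0.
- by rewrite -th01 /phi c01 d01; ring.
Qed.

(** Retraction of the line onto [0, 1]; it extends a curve given on [0, 1] to a continuous map on
    all of R. *)
Definition clamp (x : R) : R := (1 + `|x| - `|x - 1|) / 2.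

Lemma clamp_itv x : clamp x \in `[0, 1].
Proof.
rewrite in_itv /= /clamp.
by have [] := ger0P x; have [] := ger0P (x - 1); lra.
Qed.

Lemma clamp_id x : x \in `[0, 1] -> clamp x = x.
Proof.
rewrite in_itv /= => /andP[x0 x1].
by rewrite /clamp ger0_norm // ler0_norm ?subr_le0 //; field.
Qed.

Lemma clamp_continuous : continuous clamp.
Proof.
move=> x; apply: cvgM; last exact: cvg_cst.
apply: cvgB; last by apply: cvg_norm; apply: cvgB; [exact: cvg_id|exact: cvg_cst].
by apply: cvgD; [exact: cvg_cst|apply: cvg_norm; exact: cvg_id].
Qed.

Lemma clamp_comp_continuous c :
  {within `[0, 1], continuous c} -> continuous (c \o clamp).
Proof.
move=> /subspace_continuousP cc x; apply: cvg_trans (cc _ (clamp_itv x)).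
move=> A /= wA; change (nbhs x ((c \o clamp) @^-1` A)).
apply: (@filterS _ _ (nbhs_filter (x : R)) _ _ _ (clamp_continuous x _ wA)) => y.
by apply; exact: clamp_itv.
Qed.

(** The parameters [s] at which the winding number is [k] form an open and closed set containing 0,
    and the line is connected. Injectivity of [H s] keeps the moving loop off the moving base
    point. *)
Lemma isotopy_winding (H : R -> R * R -> R * R) p c k :
  continuous (fun q : R * (R * R) => H q.1 q.2) ->
  (forall s, injective (H s)) -> loop_avoiding p c ->
  has_winding_number (H 0 p) (H 0 \o c) k ->
  has_winding_number (H 1 p) (H 1 \o c) k.
Proof.
move=> cH iH [cc c01 cp] W0.
pose D s t := H s (c (clamp t)) - H s p.
have Dn0 s t : 0 < dot (D s t) (D s t).
  have : D s t != 0 by rewrite subr_eq0 (inj_eq (iH s)) cp // clamp_itv.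
  rewrite /dot -!expr2 lt_def addr_ge0 ?sqr_ge0 // andbT paddr_eq0 ?sqr_ge0 //.
  rewrite !sqrf_eq0; apply: contraNN => /andP[/eqP e1 /eqP e2].
  by rewrite (surjective_pairing (D s t)) e1 e2.
have cD : continuous (fun q : R * R => D q.1 q.2).
  move=> [s t]; have cs : q.1 @[q --> (s, t)] --> s by exact: cvg_fst.
  have ct : c (clamp q.2) @[q --> (s, t)] --> c (clamp t).
    have c2 : q.2 @[q --> (s, t)] --> t by exact: cvg_snd.
    exact: (cvg_comp _ _ c2 (clamp_comp_continuous c cc t)).
  apply: cvgB.
    exact: (cvg_comp _ _ (cvg_pair cs ct) (cH (s, c (clamp t)))).
  exact: (cvg_comp _ _ (cvg_pair cs (cvg_cst p)) (cH (s, p))).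
(* Compactness of [0, 1] gives one neighbourhood of [s0] that works for every [t]. *)
have loc s0 : \forall s \near s0, forall t, t \in `[0, 1] ->
    0 < dot (D s0 t) (D s t).
  have /compact_near_coveringP K := @segment_compact R 0 1.
  apply: (K R (nbhs s0) (fun s t => 0 < dot (D s0 t) (D s t))) => t _.
  pose F := filter_prod (nbhs t) (nbhs s0).
  have Ds0 : D s0 q.1 @[q --> F] --> D s0 t.
    have ct : (s0, q.1) @[q --> F] --> (s0, t).
      exact: (cvg_pair (cvg_cst s0) cvg_fst).
    exact: (cvg_comp _ _ ct (cD (s0, t))).
  have Ds : D q.2 q.1 @[q --> F] --> D s0 t.
    have ct : (q.2, q.1) @[q --> F] --> (s0, t).
      exact: (cvg_pair cvg_snd cvg_fst).
    exact: (cvg_comp _ _ ct (cD (s0, t))).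
  have cdot : dot (D s0 q.1) (D q.2 q.1) @[q --> F] --> dot (D s0 t) (D s0 t).
    apply: cvgD; apply: cvgM.
    - exact: (cvg_comp _ _ Ds0 cvg_fst).
    - exact: (cvg_comp _ _ Ds cvg_fst).
    - exact: (cvg_comp _ _ Ds0 cvg_snd).
    - exact: (cvg_comp _ _ Ds cvg_snd).
  exact: (cvgr_gt _ cdot _ (Dn0 s0 t)).
pose W : set R := [set s | has_winding_number (H s p) (H s \o c) k].
have Hc s : {within `[0, 1], continuous (H s \o c)}.
  apply: within_continuous_comp => // z _.
  have cz : (s, z') @[z' --> z] --> (s, z) by exact: (cvg_pair (cvg_cst s) cvg_id).
  exact: (cvg_comp _ _ cz (cH (s, z))).
(* Having a positive dot product is symmetric, so the winding number passes both from [s0] to [s]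
   and back; thus [W] and its complement are open. *)
have near_W s0 : \forall s \near s0, W s <-> W s0.
  apply: filterS (loc s0) => s hs.
  have Hd t : t \in `[0, 1] -> 0 < dot (H s0 (c t) - H s0 p) (H s (c t) - H s p).
    by move=> t01; have := hs t t01; rewrite /D clamp_id.
  split; apply: has_winding_number_close => //=; rewrite ?c01 // => t t01.
  by rewrite dotC; exact: Hd.
have WT : W = setT.
  have /connected_intervalP cT : is_interval [set: R] by [].
  apply: (cT W); first by exists 0.
    exists W; last by rewrite setTI.
    rewrite openE => s Ws; apply: filterS (near_W s) => s' [_]; exact.
  exists W; last by rewrite setTI.
  rewrite -[W]setCK; apply: open_closedC; rewrite openE => s nWs.
  apply: filterS (near_W s) => s' [h _] /h; exact: nWs.
by have : W 1 by rewrite WT.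
Qed.

(** The reflection at s = 0 turns an angle th into pi - th and so negates winding numbers; the
    isotopy carries this to s = 1. *)
Lemma orientation_reversing_isotopy (H : R -> R * R -> R * R) :
  continuous (fun q : R * (R * R) => H q.1 q.2) ->
  (forall s, injective (H s)) -> (forall z, H 0 z = (- z.1, z.2)) ->
  orientation_reversing (H 1).
Proof.
move=> cH iH H0 p c k lc [rh [th [cth hth th01]]].
apply: isotopy_winding => //; exists rh, (fun t => pi - th t); split.
- apply/subspace_continuousP => t t01; apply: cvgB; first exact: cvg_cst.
  exact: ((subspace_continuousP _ th).1 cth t t01).
- move=> t t01; have [r0 ctE] := hth t t01; split=> //=.
  by rewrite !H0 ctE /= cosB sinB cospi sinpi; congr (_, _); ring.
- by rewrite mulrNz mulNr -th01; ring.
Qed.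

End Homotopy.

(** * Dynamics *)

Section Phase.
Context {R : realType}.
Implicit Types (t b w : R).

(* The conjugacy [(w, t) -> (w - phase t, t)] with [w] the logarithm of [ratio]
   turns [twist drift 1] into the glide reflection [(w, t) -> (- w, t + 1)]. *)
Definition root4 t : R := Num.sqrt (Num.sqrt `|t|).
Definition phase t : R :=
  root4 t ^+ 2 * cos (pi * t) + root4 t * sin (pi * t).
Definition drift t : R := phase t + phase (t + 1).

Lemma root4_continuous : continuous root4.
Proof.
move=> t; have n : `|x| @[x --> t] --> `|t| by apply: cvg_norm; exact: cvg_id.
have s := cvg_comp _ _ n (@sqrt_continuous R `|t|).
exact: (cvg_comp _ _ s (@sqrt_continuous R _)).
Qed.

Lemma phase_continuous : continuous phase.
Proof.
move=> t; have pt : pi * x @[x --> t] --> pi * t.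
  by apply: cvgM; [exact: cvg_cst|exact: cvg_id].
apply: cvgD; apply: cvgM.
- by apply: cvg_sqr; exact: root4_continuous.
- exact: (cvg_comp _ _ pt (@continuous_cos R _)).
- exact: root4_continuous.
- exact: (cvg_comp _ _ pt (@continuous_sin R _)).
Qed.

Lemma shift_cvg b t : x + b @[x --> t] --> t + b.
Proof. by apply: cvgD; [exact: cvg_id|exact: cvg_cst]. Qed.

Lemma drift_continuous : continuous drift.
Proof.
move=> t; apply: cvgD; first exact: phase_continuous.
exact: (cvg_comp _ _ (shift_cvg 1 t) (phase_continuous _)).
Qed.

Lemma sqrt_dist_le (x y : R) : 1 <= x -> 0 <= y ->
  `|Num.sqrt x - Num.sqrt y| <= `|x - y| / Num.sqrt x.
Proof.
move=> x1 y0; have x0 : 0 <= x by lra.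
have sx : 0 < Num.sqrt x by rewrite sqrtr_gt0; lra.
have -> : x - y = (Num.sqrt x - Num.sqrt y) * (Num.sqrt x + Num.sqrt y).
  by rewrite -subr_sqr !sqr_sqrtr.
rewrite ler_pdivlMr // normrM.
rewrite ler_wpM2l // ger0_norm ?addr_ge0 ?sqrtr_ge0 //.
by rewrite lerDl sqrtr_ge0.
Qed.

Lemma root4_sqr t : root4 t ^+ 2 = Num.sqrt `|t|.
Proof. by rewrite sqr_sqrtr // sqrtr_ge0. Qed.

(** A shift by 1 changes the sign of cos (pi t) and sin (pi t), so only increments of |t|^(1/2) and
    |t|^(1/4) remain, each at most |t|^(-1/2). *)
Lemma drift_le t : 1 <= `|t| -> `|drift t| <= 2 / Num.sqrt `|t|.
Proof.
move=> t1; have s1 : 1 <= Num.sqrt `|t| by rewrite -sqrtr1 ler_sqrt.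
have q1 : 1 <= root4 t by rewrite -sqrtr1 ler_sqrt.
have -> : drift t = cos (pi * t) * (root4 t ^+ 2 - root4 (t + 1) ^+ 2)
   + sin (pi * t) * (root4 t - root4 (t + 1)).
  have pt : pi * (t + 1) = pi * t + pi by rewrite mulrDr mulr1.
  by rewrite /drift /phase pt (cosD (pi * t)) (sinD (pi * t)) cospi sinpi; ring.
have l1 : `|root4 t ^+ 2 - root4 (t + 1) ^+ 2| <= 1 / Num.sqrt `|t|.
  rewrite !root4_sqr (le_trans (sqrt_dist_le _ _ _ _)) //.
  rewrite ler_pM2r ?invr_gt0 ?(lt_le_trans ltr01) //.
  by rewrite (le_trans (ler_dist_dist _ _)) // opprD addrA subrr sub0r normrN normr1.
have l2 : `|root4 t - root4 (t + 1)| <= 1 / Num.sqrt `|t|.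
  rewrite (le_trans _ l1) //.
  have := sqrt_dist_le _ _ s1 (sqrtr_ge0 `|t + 1|).
  rewrite -/(root4 t) -/(root4 (t + 1)) -!root4_sqr => /le_trans; apply.
  by rewrite ler_pdivrMr ?ler_peMr // (lt_le_trans ltr01).
rewrite (le_trans (ler_normD _ _)) // !normrM.
have -> : 2 / Num.sqrt `|t| = 1 / Num.sqrt `|t| + 1 / Num.sqrt `|t| by lra.
have sm : `|sin (pi * t)| <= 1 by exact: sin_max.
by apply: lerD; rewrite -[leRHS]mul1r ler_pM // cos_max.
Qed.

Lemma drift_vanishes : vanishes_at_infinity drift.
Proof.
(* The term 4 / e^2 solves 2 / |t|^(1/2) < e, and the 1 ensures the hypothesis of [drift_le]. *)
move=> e e0; exists (1 + 4 / e ^+ 2) => t ht.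
have e2 : 0 < 4 / e ^+ 2 by rewrite divr_gt0 ?exprn_gt0.
have t1 : 1 <= `|t| by lra.
rewrite (le_lt_trans (drift_le t t1)) // ltr_pdivrMr ?sqrtr_gt0 ?(lt_le_trans ltr01) //.
rewrite -(@ltr_pXn2r _ 2) ?nnegrE ?mulr_ge0 ?sqrtr_ge0 ?(ltW e0) //.
rewrite exprMn sqr_sqrtr //.
have : 4 / e ^+ 2 < `|t| by lra.
by rewrite ltr_pdivrMr ?exprn_gt0 // mulrC; lra.
Qed.

Lemma drift_shift_vanishes : vanishes_at_infinity (fun t => - drift (t - 1)).
Proof.
move=> e e0; have [M hM] := drift_vanishes e e0; exists (M + 1) => t ht.
rewrite normrN hM //; have := ler_normD (t - 1) 1; rewrite subrK normr1; lra.
Qed.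

Lemma cos_sin_alternate t b n : b ^+ 2 = 1 ->
  cos (pi * (t + n%:R * b)) = (-1) ^+ n * cos (pi * t) /\
  sin (pi * (t + n%:R * b)) = (-1) ^+ n * sin (pi * t).
Proof.
move=> b2; have cb : cos (pi * b) = -1 /\ sin (pi * b) = 0.
  have /eqP := b2; rewrite sqrf_eq1 => /orP[] /eqP ->.
    by rewrite mulr1 cospi sinpi.
  by rewrite mulrN1 cosN sinN cospi sinpi oppr0.
elim: n => [|n [IHc IHs]]; first by rewrite !mul0r !addr0 !mul1r.
have -> : pi * (t + n.+1%:R * b) = pi * (t + n%:R * b) + pi * b.
  by rewrite -natr1; ring.
by rewrite (cosD _ (pi * b)) (sinD _ (pi * b)) IHc IHs cb.1 cb.2 exprS; split; ring.
Qed.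

(* Along an integer orbit the square term dominates unless its coefficient
   [cos (pi * t)] is zero, in which case the other coefficient is not. *)
Lemma phase_diverges t b : b ^+ 2 = 1 -> exists2 sg : R, sg ^+ 2 = 1 &
  sg * (-1) ^+ n * phase (t + n%:R * b) @[n --> \oo] --> +oo.
Proof.
move=> b2; set C := cos (pi * t); set S := sin (pi * t).
have CS : C ^+ 2 + S ^+ 2 = 1 by exact: cos2Dsin2.
have nb : `|b| = 1.
  by apply/eqP; rewrite -(@eqrXn2 _ 2) // real_normK ?num_real // b2 expr1n.
have rt A : \forall n \near \oo, A < root4 (t + n%:R * b).
  near=> n.
  (* As |t + n b| >= n - |t|, this puts |t + n b| above (1 + |A|)^4. *)
  have h : (1 + `|A|) ^+ 4 + `|t| < n%:R by near: n; exact: nbhs_infty_gtr.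
  have tn : n%:R - `|t| <= `|t + n%:R * b|.
    have := lerB_normD (n%:R * b) t; rewrite [_ * b + t]addrC normrM nb mulr1.
    by rewrite ger0_norm.
  have A0 : 0 <= 1 + `|A| by rewrite addr_ge0.
  rewrite (lt_le_trans (_ : A < 1 + `|A|)) //; first by have := ler_norm A; lra.
  rewrite -(@ler_pXn2r _ 2) ?nnegrE ?sqrtr_ge0 // root4_sqr.
  rewrite -(@ler_pXn2r _ 2) ?nnegrE ?sqrtr_ge0 ?exprn_ge0 // sqr_sqrtr // -exprM.
  by lra.
have phE n : (-1) ^+ n * phase (t + n%:R * b) =
    root4 (t + n%:R * b) * (root4 (t + n%:R * b) * C + S).
  have [cE sE] := cos_sin_alternate t b n b2; rewrite /phase cE sE -/C -/S.
  have := sqrr_sign R n; set e := (-1) ^+ n => e2.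
  set r := root4 _; transitivity (e ^+ 2 * (r * (r * C + S))); first by ring.
  by rewrite e2 mul1r.
have [C0|C0] := eqVneq C 0.
  have S2 : S ^+ 2 = 1 by rewrite -CS C0; ring.
  exists S => //; apply/cvgryPgt => A; apply: filterS (rt A) => n.
  by rewrite -mulrA phE C0 mulr0 add0r mulrCA -expr2 S2 mulr1.
exists (Num.sg C); first by rewrite sqr_sg C0.
apply/cvgryPgt => A; near=> n.
(* With r the fourth root, r |C| > 2 dominates the sine term of size at most 1, so the second factor
   exceeds 1 and the product exceeds r > |A|. *)
have h1 : 2 / `|C| < root4 (t + n%:R * b) by near: n; exact: rt.
have h2 : `|A| < root4 (t + n%:R * b) by near: n; exact: rt.
rewrite -mulrA phE; set r := root4 _ in h1 h2 *.
have nC : 0 < `|C| by rewrite normr_gt0.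
have S1 : `|S| <= 1 by exact: sin_max.
have sS : `|Num.sg C * S| <= 1 by rewrite normrM normr_sg C0 mul1r.
have -> : Num.sg C * (r * (r * C + S)) = r * (r * `|C| + Num.sg C * S).
  by rewrite normrEsg; ring.
move: h1; rewrite ltr_pdivrMr // => h1.
have := ler_norm A; have := normr_ge0 A; move: sS; rewrite ler_norml => /andP[sS _].
by nra.
Unshelve. all: by end_near.
Qed.

End Phase.

(** * Limit sets of alternating orbits *)

Section OmegaLimit.
Context {R : realType}.
Implicit Types (z : R * R) (f : R * R -> R * R) (s : R).

Lemma bounded_range (z_ : nat -> R * R) s :
  s ^+ 2 = 1 ->
  s * (-1) ^+ n * (z_ n).1 @[n --> \oo] --> (1 : R) ->
  (z_ n).2 @[n --> \oo] --> (0 : R) ->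
  exists M, forall n, `|z_ n| <= M.
Proof.
move=> s2 c1 c2; have ns : `|s| = 1.
  by apply/eqP; rewrite -(@eqrXn2 _ 2) // real_normK ?num_real // s2 expr1n.
have bound (u : nat -> R) : cvgn u -> exists M, forall n, `|u n| <= M.
  move=> /cvg_seq_bounded; rewrite /bounded_near => -[M [_ hM]].
  exists (M + 1) => n; apply: hM => //; lra.
have [M1 h1] := bound _ (cvgP _ c1); have [M2 h2] := bound _ (cvgP _ c2).
exists (Num.max M1 M2) => n; rewrite prod_normE ge_max !le_max h2 orbT andbT.
by have := h1 n; rewrite !normrM normrX normrN1 expr1n ns !mul1r => ->.
Qed.

(** The squares of the first coordinates tend to 1, leaving only the two poles as limit points; the
    iterates of each parity converge to one of them. *)
Lemma omega_limit_alternating f z s :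
  s ^+ 2 = 1 ->
  s * (-1) ^+ n * (iter n f z).1 @[n --> \oo] --> (1 : R) ->
  (iter n f z).2 @[n --> \oo] --> (0 : R) ->
  omega_limit f z = [set (-1, 0); (1, 0)].
Proof.
move=> s2 c1 c2; apply/seteqP; split => [y [ns [_ incr cy]]|].
  have nI i : (i <= ns i)%N by elim: i => // i /leq_ltn_trans; apply; exact: incr.
  have noo : ns i @[i --> \oo] --> \oo.
    by move=> A [N _ hN]; exists N => // i /= Ni; apply: hN; exact: leq_trans (nI i).
  have y2 : y.2 = 0.
    have l1 : (iter (ns i) f z).2 @[i --> \oo] --> y.2.
      exact: (cvg_comp _ _ cy cvg_snd).
    have l2 : (iter (ns i) f z).2 @[i --> \oo] --> (0 : R).
      exact: (cvg_comp _ _ noo c2).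
    exact: (@norm_cvg_unique _ R^o _ _ _ _ l1 l2).
  have y1 : y.1 ^+ 2 = 1.
    have l1 : (iter (ns i) f z).1 ^+ 2 @[i --> \oo] --> y.1 ^+ 2.
      by apply: cvg_sqr; exact: (cvg_comp _ _ cy cvg_fst).
    have l2 : (iter (ns i) f z).1 ^+ 2 @[i --> \oo] --> (1 ^+ 2 : R).
      have -> : (fun i => (iter (ns i) f z).1 ^+ 2) =
          (fun i => (s * (-1) ^+ ns i * (iter (ns i) f z).1) ^+ 2).
        by apply/funext => i; rewrite !exprMn s2 sqrr_sign !mul1r.
      by apply: cvg_sqr; exact: (cvg_comp _ _ noo c1).
    by rewrite (@norm_cvg_unique _ R^o _ _ _ _ l1 l2) expr1n.
  move/eqP: y1; rewrite sqrf_eq1 (surjective_pairing y) y2 /=.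
  by move=> /orP[] /eqP ->; [right|left].
suff H (e : bool) : omega_limit f z ((-1) ^+ e * - s, 0).
  have /eqP := s2; rewrite sqrf_eq1 => /orP[] /eqP sE y [] ->.
  - by have := H false; rewrite sE mul1r.
  - by have := H true; rewrite sE expr1 mulrNN mul1r.
  - by have := H true; rewrite sE expr1 opprK mulN1r.
  - by have := H false; rewrite sE opprK mul1r.
(* The 1 keeps the indices positive and [e] selects their parity. *)
pose ns i := (i.*2 + 1 + e)%N; exists ns; split.
- by move=> i; rewrite /ns addn1 addSn.
- by move=> i; rewrite /ns doubleS !addn1 !addSn ltnS leqnSn.
have noo : ns i @[i --> \oo] --> \oo.
  move=> A [N _ hN]; exists N => // i /= Ni; apply: hN => /=.
  by rewrite /ns (leq_trans Ni) // -addnn -!addnA leq_addr.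
have -> : (fun i => iter (ns i) f z) =
    (fun i => ((iter (ns i) f z).1, (iter (ns i) f z).2)).
  by apply/funext => i; exact: surjective_pairing.
apply: cvg_to_pair; last exact: (cvg_comp _ _ noo c2).
have -> : (fun i => (iter (ns i) f z).1) =
    (fun i => (-1) ^+ e * - s * (s * (-1) ^+ ns i * (iter (ns i) f z).1)).
  apply/funext => i.
  have -> : (-1) ^+ ns i = - (-1) ^+ e :> R.
    by rewrite /ns !exprD expr1 -muln2 exprM sqrr_sign mul1r mulN1r.
  transitivity (s ^+ 2 * ((-1) ^+ e) ^+ 2 * (iter (ns i) f z).1); last by ring.
  by rewrite s2 sqrr_sign !mul1r.
rewrite -[X in _ --> X]mulr1; apply: cvgM; first exact: cvg_cst.
exact: (cvg_comp _ _ noo c1).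
Qed.

End OmegaLimit.

(** * Orbits of maps conjugate to a glide reflection *)

Section Glide.
Context {R : realType}.
Implicit Types (z : R * R) (t v w s : R).

(** The squared distance to (1, 0) is [beta], which is at most 4 / (exp v - 1)^2, and exp v - 1 >=
    v. The bound is uniform in [t]. *)
Lemma chart_near1 v t : 0 < v ->
  `|(chart (expR v) t).1 - 1| <= 2 / v /\ `|(chart (expR v) t).2| <= 2 / v.
Proof.
move=> v0; have a0 := expR_gt0 v; have a1 := expR_ge1Dx v.
set a := expR v in a0 a1 *.
have d0 := chart_den_gt0 a t a0.
have v2 : 0 <= 2 / v by rewrite divr_ge0 // ltW.
have bE : beta (chart a t) =
    4 * (1 + t ^+ 2) / ((a - 1) ^+ 2 * (1 + t ^+ 2) + 4 * a).
  by move/lt0r_neq0: d0 => d1; rewrite /beta /chart /=; field.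
have b4 : beta (chart a t) <= (2 / v) ^+ 2.
  rewrite bE expr_div_n ler_pdivrMr // mulrAC ler_pdivlMr ?exprn_gt0 //.
  have va : v ^+ 2 <= (a - 1) ^+ 2 by rewrite lerXn2r ?nnegrE; lra.
  have t0 : 0 <= 1 + t ^+ 2 by rewrite addr_ge0 ?sqr_ge0.
  have := ler_wpM2r t0 va; lra.
have le x : x ^+ 2 <= beta (chart a t) -> `|x| <= 2 / v.
  move=> xb; rewrite -(@ler_pXn2r _ 2) ?nnegrE // real_normK ?num_real //.
  exact: le_trans b4.
by split; apply: le; rewrite /beta -[(1 - _) ^+ 2]sqrrN opprB ?lerDl ?lerDr sqr_ge0.
Qed.

Lemma chart_near_pole s v t : s ^+ 2 = 1 -> 0 < v ->
  `|s * (chart (expR (s * v)) t).1 - 1| <= 2 / v /\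
  `|(chart (expR (s * v)) t).2| <= 2 / v.
Proof.
move=> s2 v0; have [h1 h2] := chart_near1 v t v0.
have /eqP := s2; rewrite sqrf_eq1 => /orP[] /eqP ->; first by rewrite !mul1r.
by rewrite !mulN1r expRN chart_inv ?expR_gt0 //= opprK.
Qed.

Context (f : R * R -> R * R) (b : R).
Hypothesis b2 : b ^+ 2 = 1.
Hypothesis fE : forall w t,
  f (chart (expR w) t) = chart (expR (phase t + phase (t + b) - w)) (t + b).

(** Each step negates w - [phase t] and adds [b] to t. The cases b = 1 and b = -1 serve the map and
    its inverse. *)
Lemma iter_glide n w t : iter n f (chart (expR w) t) =
  chart (expR (phase (t + n%:R * b) + (-1) ^+ n * (w - phase t))) (t + n%:R * b).
Proof.
elim: n => [|n IH]; first by rewrite mul0r addr0 mul1r addrC subrK.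
have tE : t + n%:R * b + b = t + n.+1%:R * b by rewrite -natr1; ring.
by rewrite iterS IH fE tE; congr (chart (expR _) _); rewrite exprS; ring.
Qed.

Lemma glide_orbit z : ~~ slit z -> exists2 s : R, s ^+ 2 = 1 &
  s * (-1) ^+ n * (iter n f z).1 @[n --> \oo] --> (1 : R) /\
  (iter n f z).2 @[n --> \oo] --> (0 : R).
Proof.
move=> nz; pose w := ln (ratio z); pose t := height z.
have zE : z = chart (expR w) t by rewrite /w lnK ?posrE ?ratio_gt0 ?chartK.
have [s s2 /cvgryPgt hs] := phase_diverges t b b2; exists s => //.
have key e : 0 < e -> \forall n \near \oo,
    `|s * (-1) ^+ n * (iter n f z).1 - 1| < e /\ `|(iter n f z).2| < e.
  (* The constant |w - phase t| is the most by which the bounded term can lower the signed exponent,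
     which thus stays above 2 / e. *)
  move=> e0; apply: filterS (hs (2 / e + `|w - phase t|)) => n hn.
  set sn := s * (-1) ^+ n in hn *.
  have sn2 : sn ^+ 2 = 1 by rewrite exprMn s2 sqrr_sign mulr1.
  have e2 : 0 < 2 / e by rewrite divr_gt0.
  rewrite zE iter_glide; set W := phase _ + _.
  have vW : W = sn * (sn * W) by rewrite mulrA -expr2 sn2 mul1r.
  have v0 : 2 / e < sn * W.
    rewrite /W mulrDr; have : - `|w - phase t| <= sn * ((-1) ^+ n * (w - phase t)).
      rewrite /sn -mulrA [_ * (_ * (w - _))]mulrA -expr2 sqrr_sign mul1r.
      have /eqP := s2; rewrite sqrf_eq1 => /orP[] /eqP ->.
        by rewrite mul1r lerNl -normrN ler_norm.
      by rewrite mulN1r lerN2 ler_norm.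
    lra.
  have v1 : 0 < sn * W by lra.
  have ve : 2 / (sn * W) < e.
    by rewrite ltr_pdivrMr // mulrC -ltr_pdivrMr.
  rewrite vW; have [h1 h2] := chart_near_pole sn _ (t + n%:R * b) sn2 v1.
  by split; [exact: le_lt_trans h1 ve|exact: le_lt_trans h2 ve].
split.
  by apply/cvgrPdistC_lt => e e0; apply: filterS (key e e0) => n [].
by apply/cvgr0Pnorm_lt => e e0; apply: filterS (key e e0) => n [].
Qed.

(** The [n]-th iterate moves [height] by n b, which is nonzero. *)
Lemma glide_aperiodic z n : ~~ slit z -> (0 < n)%N -> iter n f z != z.
Proof.
move=> nz n0; pose w := ln (ratio z); pose t := height z.
have zE : z = chart (expR w) t by rewrite /w lnK ?posrE ?ratio_gt0 ?chartK.
rewrite zE iter_glide; apply: contraTneq n0 => /(congr1 height).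
rewrite !height_chart ?expR_gt0 // => /eqP; rewrite -subr_eq0 addrAC subrr add0r.
rewrite mulf_eq0 pnatr_eq0 => /orP[/eqP ->//|/eqP b0].
by move: b2; rewrite b0 expr0n => /eqP; rewrite eq_sym oner_eq0.
Qed.

End Glide.

Lemma drift_glide {R : realType} (w t : R) :
  twist drift 1 (chart (expR w) t)
    = chart (expR (phase t + phase (t + 1) - w)) (t + 1).
Proof. by rewrite twist_chart ?expR_gt0 // mul1r -expRB. Qed.

Lemma drift_glide_inv {R : realType} (w t : R) :
  twist (fun t => - drift (t - 1)) (-1) (chart (expR w) t)
    = chart (expR (phase t + phase (t + -1) - w)) (t + -1).
Proof.
rewrite twist_chart ?expR_gt0 // mulN1r opprK -expRB /drift subrK.
by rewrite [phase t + _]addrC.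
Qed.

Theorem theorem1p4 (R : realType) :
  exists h g : R * R -> R * R,
    [/\ homeomorphism_with_inverse h g,
        orientation_reversing h,
        (forall x : R * R, ~ fixed_point h x),
        ((forall x : R * R, periodic_point h x -> n_periodic_point 2 h x) /\
         [set x : R * R | periodic_point h x] =
           (`]-oo, (-1 : R)] `|` `[(1 : R), +oo[) `*` [set (0 : R)]) &
        (forall x : R * R, ~ periodic_point h x ->
           [/\ bounded_set (full_orbit h g x),
               omega_limit h x = [set (-1, 0); (1, 0)] &
               alpha_limit g x = [set (-1, 0); (1, 0)]])].
Proof.
pose h : R * R -> R * R := twist drift 1.
pose g : R * R -> R * R := twist (fun t => - drift (t - 1)) (-1).
have hE := @drift_glide R; have gE := @drift_glide_inv R.
have one2 : (1 : R) ^+ 2 = 1 by rewrite expr1n.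
have N12 : (-1 : R) ^+ 2 = 1 by rewrite sqrrN.
have nofix x : ~ fixed_point h x.
  have [sx|nx] := boolP (slit x); last first.
    by move=> hx; have /eqP := glide_aperiodic _ _ one2 hE _ 1 nx isT.
  rewrite /fixed_point /h twist_slit // => /(congr1 fst) /= x1.
  have x0 : x.1 = 0 by lra.
  by move: sx; rewrite /slit x0 normr0 ler10 andbF.
have per2 x : slit x -> iter 2 h x = x.
  move=> sx; rewrite /= /h (twist_slit _ _ _ sx) twist_slit ?slit_reflect //=.
  by rewrite opprK -surjective_pairing.
have periodE x : periodic_point h x <-> slit x.
  split=> [[n n0 hn]|sx].
    by apply/negPn/negP => nx; have /eqP := glide_aperiodic _ _ one2 hE _ n nx n0.
  by exists 2%N => //; exact: per2.
exists h, g; split=> //.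
- split.
  + move=> z; apply: (twist_cvg _ drift_continuous drift_vanishes id (cst 1)).
      exact: cvg_id.
    exact: cvg_cst.
  + move=> z.
    have cd : continuous (fun t : R => - drift (t - 1)).
      move=> t; apply: cvgN.
      exact: (cvg_comp _ _ (shift_cvg (-1) t) (drift_continuous _)).
    apply: (twist_cvg _ cd drift_shift_vanishes id (cst (-1))).
      exact: cvg_id.
    exact: cvg_cst.
  + exact: twistK.
  + exact: twistVK.
- apply: (orientation_reversing_isotopy (twist drift)).
  + by move=> q; apply: (twist_cvg _ drift_continuous drift_vanishes snd fst);
      [exact: cvg_snd|exact: cvg_fst].
  + move=> s; exact: can_inj (twistK _ _).
  + exact: twist0.
- split=> [x px|].
    split=> //; last first.
      (* Period 1 is the only smaller candidate, and it would give a fixed point. *)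
      by case=> [|[|m]] // _ /nofix.
    by apply: per2; apply/periodE.
  apply/seteqP; split => x /=; rewrite periodE => /slitP //.
- move=> x np; have nx : ~~ slit x by apply/negP => /periodE.
  have [s s2 [h1 h2]] := glide_orbit _ _ one2 hE _ nx.
  have [s' s'2 [g1 g2]] := glide_orbit _ _ N12 gE _ nx.
  split.
  + have [M hM] := bounded_range _ _ s2 h1 h2.
    have [M' hM'] := bounded_range _ _ s'2 g1 g2.
    exists (Num.max M M'); split; first exact: num_real.
    move=> A MA y [[n|n] ->]; apply: (le_trans _ (ltW MA)); rewrite le_max.
      by rewrite hM.
    by rewrite hM' orbT.
  + exact: omega_limit_alternating s2 h1 h2.
  + exact: omega_limit_alternating s'2 g1 g2.
Qed.
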